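(* Let $\mathbb{K}$ be one of the number fields $\mathbb{Q}(\sqrt{-d})$ or $\mathbb{Q}(\sqrt{d})$ for some square-free positive integer $d$, and let $\mathcal{O}_{\mathbb{K}}$ denote the ring of integers of $\mathbb{K}$. Consider the family of elliptic curves $C_m: Y^2=X^3-m^2X+1$, $m\in\mathcal{O}_{\mathbb{K}}$. For $m\neq 0,\sqrt{2}$, there is no point of order $2$ in the Mordell--Weil group $C_m(\mathbb{K})$.
   Context: $C_m(\mathbb{K})$ is the group of $\mathbb{K}$-rational points of $C_m$. Its points of order two correspond to the roots in $\mathbb{K}$ of the cubic polynomial $X^3-m^2X+1$.
   Formalization: The case m = −√2 is excluded along with m = √2, because C_m depends only on m² and, for m = −√2 in Q(√2), the point (1,0) on Y² = X³ − 2X + 1 has order 2. *)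

(* Defs.v *)
From HB Require Import structures.
From mathcomp Require Import all_boot all_order all_algebra all_field.
From mathcomp Require Import ring.

Set Implicit Arguments.
Unset Strict Implicit.
Unset Printing Implicit Defensive.

Import GRing.Theory.
Local Open Scope ring_scope.

Definition squarefree (d : nat) : Prop :=
  forall p : nat, prime p -> ~~ (p ^ 2 %| d)%N.

(* K = Q(sqrt a).  Since a may be a square, the degree 1 case K = Q is
   included. *)
Definition is_Qsqrt (K : fieldExtType rat) (a : int) : Prop :=
  exists s : K, s ^+ 2 = a%:~R /\ <<1; s>>%VS = {:K}%VS.

Definition in_ring_of_integers (K : fieldExtType rat) (x : K) : Prop :=
  integralOver (intr : int -> K) x.

Section WeierstrassCurve.
Variables (F : fieldType) (a b : F).

(* The projective points of Y^2 = X^3 + a X + b over F: [None] is the point at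
   infinity. *)
Definition on_curve (P : option (F * F)) : bool :=
  if P is Some (x, y) then y ^+ 2 == x ^+ 3 + a * x + b else true.

Definition chord_tangent_slope (x1 y1 x2 y2 : F) : F :=
  if x1 == x2 then (3 * x1 ^+ 2 + a) / (2 * y1) else (y2 - y1) / (x2 - x1).

Definition add_coord (P Q : option (F * F)) : option (F * F) :=
  match P, Q with
  | None, _ => Q
  | _, None => P
  | Some (x1, y1), Some (x2, y2) =>
      if (x1 == x2) && (y1 == - y2) then None else
      let l := chord_tangent_slope x1 y1 x2 y2 in
      let x3 := l ^+ 2 - x1 - x2 in
      Some (x3, l * (x1 - x3) - y1)
  end.

Lemma add_coord_on_curve P Q :
  on_curve P -> on_curve Q -> on_curve (add_coord P Q).
Proof.
case: P => [[x1 y1]|] //; case: Q => [[x2 y2]|] //=.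
move=> /eqP h1 /eqP h2; case: ifPn => //= h; rewrite /chord_tangent_slope.
have [e|ne] := eqVneq x1 x2; last first.
  have ne' : x2 - x1 != 0 by rewrite subr_eq0 eq_sym.
  set l := _ / _; have hl : l * (x2 - x1) = y2 - y1 by rewrite mulfVK.
  have e2 : y2 = y1 + l * (x2 - x1) by rewrite hl addrC subrK.
  have ha : a = l ^+ 2 * (x2 - x1) + 2 * l * y1
                - (x2 ^+ 2 + x1 * x2 + x1 ^+ 2).
    apply/(mulfI ne')/eqP; rewrite -subr_eq0; apply/eqP.
    transitivity ((x2 ^+ 3 + a * x2 + b) - (x1 ^+ 3 + a * x1 + b)
                  - (y2 ^+ 2 - y1 ^+ 2)); first by rewrite e2; ring.
    by rewrite h1 h2; ring.
  have hb : b = y1 ^+ 2 - x1 ^+ 3 - a * x1 by rewrite h1; ring.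
  by apply/eqP; rewrite hb ha; ring.
subst x2; move: h; rewrite eqxx /= => h.
have : (y1 - y2) * (y1 + y2) = 0.
  by transitivity (y1 ^+ 2 - y2 ^+ 2); [ring | rewrite h1 h2 subrr].
move/eqP; rewrite mulf_eq0 subr_eq0 addr_eq0 (negPf h) orbF => /eqP e2.
subst y2; have ny : 2 * y1 != 0.
  by apply: contra h => /eqP h; rewrite -addr_eq0 -mulr2n -mulr_natl h.
set l := _ / _; have hl : l * (2 * y1) = 3 * x1 ^+ 2 + a by rewrite mulfVK.
have ha : a = l * (2 * y1) - 3 * x1 ^+ 2 by rewrite hl; ring.
have hb : b = y1 ^+ 2 - x1 ^+ 3 - a * x1 by rewrite h1; ring.
by apply/eqP; rewrite hb ha; ring.
Qed.

Definition ec_point : Type := {P : option (F * F) | on_curve P}.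

Definition ec_zero : ec_point := exist _ None isT.

Definition ec_add (P Q : ec_point) : ec_point :=
  exist _ (add_coord (sval P) (sval Q))
    (add_coord_on_curve (svalP P) (svalP Q)).

Definition ec_mul (n : nat) (P : ec_point) : ec_point :=
  iter n (ec_add P) ec_zero.

Definition has_order (P : ec_point) (n : nat) : Prop :=
  [/\ (0 < n)%N, ec_mul n P = ec_zero &
      forall k : nat, (0 < k < n)%N -> ec_mul k P <> ec_zero].

End WeierstrassCurve.

(* The points over K of C_m : Y^2 = X^3 - m^2 X + 1. *)
Definition C_point (K : fieldType) (m : K) : Type := ec_point (- m ^+ 2) 1.

(* Main.v *)
(* A point of order 2 is (x, 0) with x (m^2 - x^2) = 1, so x is a unit of the
   ring of integers and m^2 x = x^3 + 1.  Let t, n be the trace and norm of x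
   and T, k those of m, all integers, with n = 1 or n = -1.  The norm of this
   equation and the trace of m^2 = x^2 + 1/x give
     k^2 n = n^3 + t^3 - 3 n t + 1   and   (T^2 - 2 k) n = n (t^2 - 2 n) + t.
   If n = 1, the first equation is k^2 = (t - 1)^2 (t + 2), so either t = 1
   (hence x^3 = -1 and m = 0) or t + 2 = w^2 and k = (t - 1) w, and the second
   one becomes T^2 = w (w + 2) (w^2 - 3).  For odd w the right-hand side is
   2 mod 4; for w = 2 v it is 4 v (v + 1) (4 v^2 - 3), whose factors are coprime
   up to 3, and this leaves w = 0 (x = -1, m = 0) and w = -2 (x = 1, m^2 = 2).
   If n = -1, then k^2 = - t (t^2 + 3) and T^2 = t^2 - t + 2 + 2 k.  If 3
   divides t then T^2 is 2 mod 3; otherwise t^2 + 3 is a square, so t = -1,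
   hence x^2 + x = 1 and m^2 = 2. *)

Require Import Defs.
From HB Require Import structures.
From mathcomp Require Import all_boot all_order all_algebra all_field.
From mathcomp Require Import ring zify.
Import Order.TTheory GRing.Theory Num.Theory.
Local Open Scope ring_scope.

(** * Squares and the integer equations for traces and norms *)

(** For nonzero [b], put [g = gcd(b, c)], [b = b' g], [c = c' g]. Then [a b' = g c'^2], and
    coprimality makes [b'] and [g] divide each other, so [b = g^2]. *)
Lemma coprime_mul_square (a b c : int) :
  0 <= b -> coprimez a b -> a * b = c ^+ 2 -> exists s, b = s ^+ 2.
Proof.
have [-> _ _ _|b0 b_ge0 cab abc] := eqVneq b 0.
  by exists 0; rewrite expr0n.
exists (gcdz b c); set g := gcdz b c.
have g0 : g != 0 by rewrite gcdz_eq0 negb_and b0.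
have [/dvdzP[b' eb] /dvdzP[c' ec]] := (dvdz_gcdl b c, dvdz_gcdr b c).
rewrite -/g in eb ec.
have cb'c' : coprimez b' c'.
  have [u [v uv]] := Bezoutz b c.
  apply/coprimezP; exists (u, v); apply: (mulIf g0).
  by rewrite /= mul1r -[RHS]uv eb ec; ring.
have e : a * b' = g * c' ^+ 2.
  by apply: (mulIf g0); rewrite -mulrA -eb abc ec; ring.
have b'g : (b' %| g)%Z.
  by rewrite -(Gauss_dvdzl _ (coprimezXr 2 cb'c')) -e dvdz_mull.
have cga : coprimez g a.
  by rewrite coprimez_sym; move: cab; rewrite eb coprimezMr; case/andP.
have gb' : (g %| b')%Z by rewrite -(Gauss_dvdzr _ cga) e dvdz_mulr.
have g_gt0 : 0 < g by rewrite lt_def g0.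
have b'_ge0 : 0 <= b' by move: b_ge0; rewrite eb pmulr_lge0.
suff b'E : b' = g by rewrite {1}eb b'E expr2.
rewrite -(gez0_abs b'_ge0) -(gez0_abs (ltW g_gt0)); congr Posz.
by apply/eqP; rewrite eqn_dvd -!dvdzE b'g.
Qed.

Lemma edivz_eq (m d : int) :
  0 < d -> exists q r, [/\ m = q * d + r, 0 <= r & r < d].
Proof.
move=> d_gt0; exists (m %/ d)%Z, (m %% d)%Z.
by rewrite -divz_eq modz_ge0 ?gt_eqF // ltz_pmod.
Qed.

(** Up to signs [0 <= x < s], so [x^2 + 3 >= (x + 1)^2] gives [x <= 1], and 3 is not a square. *)
Lemma square_add3 (x s : int) : x ^+ 2 + 3 = s ^+ 2 -> x = 1 \/ x = -1.
Proof.
wlog x_ge0 : x / 0 <= x => [hw|].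
  case: (lerP 0 x) => hx xs; first exact: hw.
  by have := hw (- x); rewrite sqrrN; lia.
wlog s_ge0 : s / 0 <= s => [hw|].
  by case: (lerP 0 s) => hs xs; [exact: hw xs | apply: (hw (- s)); lia].
move=> xs; left.
have lt_xs : x < s by nia.
have x_le1 : x <= 1 by nia.
have [x0|//] : x = 0 \/ x = 1 by lia.
have [] : s <= 1 \/ 2 <= s by lia.
  by move: xs; rewrite x0; nia.
by move: xs; rewrite x0; nia.
Qed.

Lemma trace_of_normN1 (t T k : int) :
  k ^+ 2 = - (t ^+ 3 + 3 * t) -> T ^+ 2 = t ^+ 2 - t + 2 + 2 * k -> t = -1.
Proof.
move=> ek eT.
have [/dvdzP[u eu]|n3] := boolP (3 %| t)%Z.
  have /dvdzP[v ev] : (3 %| k)%Z.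
    suff : (3 %| k ^+ 2)%Z by rewrite !dvdzE abszX Euclid_dvdX // andbT.
    by rewrite ek eu; apply/dvdzP; exists (- (9 * u ^+ 3 + 3 * u)); ring.
  have [q [r [eq_T r_ge0 r_lt3]]] := edivz_eq T _ (isT : (0 : int) < 3).
  exfalso; move: eT; rewrite eu ev eq_T.
  have [->|[->|->]] : r = 0 \/ r = 1 \/ r = 2 by lia.
  - nia.
  - nia.
  - nia.
have [s es] : exists s, t ^+ 2 + 3 = s ^+ 2.
  apply: (@coprime_mul_square (- t) _ k).
  - nia.
  - rewrite coprimezE abszN -coprimezE.
    suff -> : coprimez t (t ^+ 2 + 3) = coprimez t 3.
      by rewrite coprimez_sym coprimezE prime_coprime.
    by rewrite /coprimez expr2 gcdzMDl.
  - by rewrite ek; ring.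
case: (square_add3 _ _ es) => // t1.
(* [t = 1] would give [k^2 = -4]. *)
by move: ek; rewrite t1; nia.
Qed.

(** The factor [4 v^2 - 3] is prime to [v + 1], and its gcd with [v] divides 3. For nonzero [v]
    prime to 3 it is thus a square, which forces [v = 1] or [v = -1]. For [v = 3 n], division by 9
    makes [12 n^2 - 1] a square, impossible mod 4. *)
Lemma quartic_even (v z : int) :
  z ^+ 2 = v * (v + 1) * (4 * v ^+ 2 - 3) -> v = 0 \/ v = -1.
Proof.
move=> ez; case: (eqVneq v 0) => [|v0]; first by left.
right.
have [/dvdzP[n en]|n3] := boolP (3 %| v)%Z.
  have [s es] : exists s, 12 * n ^+ 2 - 1 = s ^+ 2.
    have /dvdzP[y ey] : (3 %| z)%Z.
      suff : (3 %| z ^+ 2)%Z by rewrite !dvdzE abszX Euclid_dvdX // andbT.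
      rewrite ez en; apply/dvdzP.
      by exists (n * (n * 3 + 1) * (4 * (n * 3) ^+ 2 - 3)); ring.
    apply: (@coprime_mul_square (n * (3 * n + 1)) _ y).
    - nia.
    - rewrite coprimezMl; apply/andP; split; apply/coprimezP.
        by exists (12 * n, -1) => /=; ring.
      by exists (- (12 * n - 4), 3) => /=; ring.
    - apply: (@mulfI _ (3 ^+ 2)) => //.
      by rewrite -exprMn [3 * y]mulrC -ey ez en; ring.
  have [q [r [eq_s r_ge0 r_lt2]]] := edivz_eq s _ (isT : (0 : int) < 2).
  exfalso; move: es; rewrite eq_s.
  have [->|->] : r = 0 \/ r = 1 by lia.
  - nia.
  - nia.
have [s es] : exists s, 4 * v ^+ 2 - 3 = s ^+ 2.
  apply: (@coprime_mul_square (v * (v + 1)) _ z) => //.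
  - nia.
  - rewrite coprimezMl; apply/andP; split; last first.
      by apply/coprimezP; exists (- 4 * (v - 1), 1) => /=; ring.
    suff -> : coprimez v (4 * v ^+ 2 - 3) = coprimez v 3.
      by rewrite coprimez_sym coprimezE prime_coprime.
    by rewrite -[RHS]coprimezN /coprimez expr2 mulrA gcdzMDl.
have /square_add3 s1 : s ^+ 2 + 3 = (2 * v) ^+ 2 by rewrite -es; ring.
have s2 : s ^+ 2 = 1 by case: s1 => ->.
have [v1|//] : v = 1 \/ v = -1 by nia.
(* [v = 1] would give [z^2 = 2]. *)
have [|[]] : z <= -2 \/ -1 <= z <= 1 \/ 2 <= z by lia.
- by move: ez; rewrite v1; nia.
- by move: ez; rewrite v1; nia.
- by move: ez; rewrite v1; nia.
Qed.

Lemma quartic_square (w T : int) :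
  T ^+ 2 = w * (w + 2) * (w ^+ 2 - 3) -> w = 0 \/ w = -2.
Proof.
have [v [r [-> r_ge0 r_lt2]]] := edivz_eq w _ (isT : (0 : int) < 2).
have [S [q [-> q_ge0 q_lt2]]] := edivz_eq T _ (isT : (0 : int) < 2).
have [->|->] : r = 0 \/ r = 1 by lia.
  have [->|->] : q = 0 \/ q = 1 by lia.
    rewrite !addr0 => e.
    suff : v = 0 \/ v = -1 by lia.
    apply: (@quartic_even _ S); apply: (@mulfI _ 4) => //; lia.
  by nia.
have [->|->] : q = 0 \/ q = 1 by lia.
  by move=> e; exfalso; nia.
by move=> e; exfalso; nia.
Qed.

Lemma trace_of_norm1 (t T k : int) :
    k ^+ 2 = (t - 1) ^+ 2 * (t + 2) -> T ^+ 2 = (t + 2) * (t - 1) + 2 * k ->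
  [\/ t = 1, t = 2 | t = -2].
Proof.
move=> ek eT; case: (eqVneq t 1) => [->|t1]; first by constructor 1.
have t1' : t - 1 != 0 by rewrite subr_eq0.
(* Below, [w = 0] yields [t = -2] and [w = -2] yields [t = 2]. *)
have /dvdzP[w ew] : (t - 1 %| k)%Z.
  by rewrite -(@dvdz_pexp2r _ _ 2) // ek dvdz_mulr.
have et : t + 2 = w ^+ 2.
  by apply: (mulfI (expf_neq0 2 t1')); rewrite -ek ew; ring.
have : w = 0 \/ w = -2.
  apply: (@quartic_square _ T); rewrite eT ew.
  have -> : t = w ^+ 2 - 2 by rewrite -et addrK.
  by ring.
case=> w0; first by constructor 3; move: et; rewrite w0; lia.
by constructor 2; move: et; rewrite w0; lia.
Qed.

(** * Integrality and conjugation in [K] *)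

Lemma rat_ext_intr_inj (K : fieldExtType rat) : injective (intr : int -> K).
Proof.
move=> i j; rewrite -[LHS]scaler_int -[RHS]scaler_int -!in_algE.
by move/fmorph_inj/intr_inj.
Qed.

(** The monic integer polynomial is carried over to [algC], where rational algebraic integers are
    integers. *)
Lemma integral_rat_int (K : fieldExtType rat) (q : rat) :
  integralOver (intr : int -> K) q%:A -> exists n : int, q = n%:~R.
Proof.
case=> p p_monic.
have -> : map_poly intr p = map_poly (in_alg K) (map_poly intr p).
  by rewrite -map_poly_comp; apply: eq_map_poly => n /=; rewrite scaler_int.
rewrite fmorph_root => rootq.
have /Cint_rat_Aint qint : (ratr q : algC) \in Crat by exact: Crat_rat.
suff /qint/intrP[n eqn] : (ratr q : algC) \in Aint.
  by exists n; apply: (fmorph_inj (@ratr algC)); rewrite /= eqn ratr_int.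
apply: (@root_monic_Aint (map_poly intr p)).
- have -> : map_poly intr p = map_poly (@ratr algC) (map_poly intr p).
    by rewrite -map_poly_comp; apply: eq_map_poly => n /=; rewrite ratr_int.
  by rewrite fmorph_root.
- exact: monic_map.
- by apply/polyOverP => i; rewrite coef_map /= intr_int.
Qed.

(** Stated with the boolean [==] so that [xchoose] can later select the coordinates of [z]. *)
Lemma Qsqrt_decomp (K : fieldExtType rat) (a : int) (s : K) :
  s ^+ 2 = a%:~R -> <<1; s>>%VS = {:K}%VS ->
  forall z : K, exists pq : rat * rat, z == pq.1%:A + pq.2%:A * s.
Proof.
move=> s2 sK z.
have : z \in <<1; s>>%VS by rewrite sK memvf.
move=> /Fadjoin_polyP[P /polyOver1P[Q ->] ->] {z P}.
elim/poly_ind: Q => [|Q r [[p q] /= /eqP IH]].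
  by exists (0, 0); rewrite rmorph0 horner0 /= !scale0r mul0r addr0.
exists (q * a%:~R + r, p) => /=; apply/eqP.
rewrite rmorphD rmorphM /= map_polyX map_polyC /= !hornerE IH.
by rewrite -!in_algE rmorphD rmorphM rmorph_int -s2; ring.
Qed.

(* The morphism is the identity when K = Q, so that the trace and norm of
   z are then 2 z and z^2 and the degree 1 case needs no separate treatment. *)
Lemma Qsqrt_conj (K : fieldExtType rat) (a : int) : is_Qsqrt K a ->
  exists c : {rmorphism K -> K},
    forall z, exists t n : rat, z + c z = t%:A /\ z * c z = n%:A.
Proof.
case=> s [s2 sK]; have dec := @Qsqrt_decomp K a s s2 sK.
have [/vlineP[r sr]|sQ] := boolP (s \in 1%VS).
  exists idfun => z; have [[p q] /eqP /= ->] := dec z.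
  exists (2 * (p + q * r)), ((p + q * r) ^+ 2).
  rewrite sr -!in_algE rmorphXn rmorphM rmorph_nat rmorphD rmorphM /=.
  by split; ring.
pose p z : rat := (xchoose (dec z)).1; pose q z : rat := (xchoose (dec z)).2.
have pqE z : z = (p z)%:A + (q z)%:A * s.
  by apply/eqP; exact: (xchooseP (dec z)).
(* If [v] and [v'] differed, [s] would be the rational number [(u' - u) / (v - v')]. *)
have uniq u v u' v' : u%:A + v%:A * s = u'%:A + v'%:A * s -> u = u' /\ v = v'.
  move=> e; have ev : v = v'.
    apply/eqP; apply: contraNT sQ; rewrite -subr_eq0 => nv; apply/vlineP.
    exists ((v - v')^-1 * (u' - u)).
    apply: (@mulfI _ (v - v')%:A); first by rewrite scaler_eq0 oner_eq0 orbF.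
    rewrite -!in_algE -rmorphM mulVKf // !rmorphB /=.
    transitivity (u'%:A + v'%:A * s - v'%:A * s - u%:A); last by ring.
    by rewrite -e; ring.
  split=> //; move: e; rewrite ev => /addIr.
  by rewrite -!in_algE => /fmorph_inj.
pose c (z : K) : K := (p z)%:A - (q z)%:A * s.
have cE u v : c (u%:A + v%:A * s) = u%:A - v%:A * s.
  by have [] := uniq _ _ _ _ (pqE (u%:A + v%:A * s)); rewrite /c => <- <-.
have c_add : zmod_morphism c.
  move=> x y; have -> : x - y = (p x - p y)%:A + (q x - q y)%:A * s.
    by rewrite {1}(pqE x) {1}(pqE y) -!in_algE !rmorphB; ring.
  by rewrite cE /c -!in_algE !rmorphB; ring.
have c_mul : monoid_morphism c.
  split=> [|x y].
    by have := cE 1 0; rewrite scale1r scale0r mul0r addr0 subr0.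
  have -> : x * y = (p x * p y + q x * q y * a%:~R)%:A
                    + (p x * q y + q x * p y)%:A * s.
    rewrite {1}(pqE x) {1}(pqE y) -!in_algE !rmorphD !rmorphM rmorph_int -s2.
    by ring.
  by rewrite cE /c -!in_algE !rmorphD !rmorphM rmorph_int -s2; ring.
pose cA := GRing.isZmodMorphism.Build _ _ c c_add.
pose cM := GRing.isMonoidMorphism.Build _ _ c c_mul.
pose cR : {rmorphism K -> K} := HB.pack c cA cM.
exists cR => z; exists (2 * p z), (p z ^+ 2 - a%:~R * q z ^+ 2).
have -> : cR z = (p z)%:A - (q z)%:A * s by [].
rewrite -!in_algE rmorphM rmorph_nat rmorphB rmorphXn rmorphM rmorph_int.
rewrite rmorphXn -s2 /=.
by split; rewrite {1}(pqE z) -!in_algE; ring.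
Qed.

(** The conjugate is a root of the same integer polynomial, so trace and norm are both rational and
    integral. *)
Lemma Qsqrt_integral_conj (K : fieldExtType rat) (a : int) : is_Qsqrt K a ->
  exists c : {rmorphism K -> K},
    forall z, in_ring_of_integers z ->
    exists t n : int, z + c z = t%:~R /\ z * c z = n%:~R.
Proof.
move=> /Qsqrt_conj[c cP]; exists c => z zint.
have cint : integralOver intr (c z).
  case: zint => p p_monic pz; exists p => //.
  have -> : map_poly intr p = map_poly c (map_poly intr p).
    by rewrite -map_poly_comp; apply: eq_map_poly => n /=; rewrite rmorph_int.
  by rewrite fmorph_root.
have [t [n [et en]]] := cP z.
have [t' et'] : exists t' : int, t = t'%:~R.
  by apply: (@integral_rat_int K); rewrite -et; exact: integral_add.
have [n' en'] : exists n' : int, n = n'%:~R.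
  by apply: (@integral_rat_int K); rewrite -en; exact: integral_mul.
by exists t', n'; rewrite et en et' en' !scaler_int.
Qed.

(** * Points of order 2 *)

Lemma C_order2_root (K : fieldExtType rat) (m : K) (P : C_point m) :
  has_order P 2 -> exists x : K, x ^+ 3 - m ^+ 2 * x + 1 = 0.
Proof.
case: P => [[[x y]|] hP] [_ h2 h1]; last first.
  by case: (h1 1%N isT); apply: val_inj.
exists x.
(* Doubling an affine point gives infinity only when [y = - y]. *)
have := congr1 sval h2; rewrite /= eqxx /=; case: ifP => //= /eqP y0 _.
have {}y0 : y = 0.
  have /eqP : y * 2 = 0 by rewrite mulr_natr mulr2n {1}y0 addNr.
  by rewrite mulf_eq0 => /orP[/eqP//|/eqP/(@rat_ext_intr_inj K 2 0)].
by move: (hP); rewrite /= y0 expr0n eq_sym mulNr => /eqP.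
Qed.

(* [m] differs from both square roots of 2 in K: the abstract field K does not
   distinguish them, and C_m only depends on m ^+ 2. *)
Theorem corollary1p2 (K : fieldExtType rat) (d : nat)
    (d_gt0 : (0 < d)%N) (d_sqfree : squarefree d)
    (hK : is_Qsqrt K (- d%:Z) \/ is_Qsqrt K d%:Z)
    (m : K) (m_int : in_ring_of_integers m)
    (m_neq0 : m <> 0)
    (m_neq_sqrt2 : forall r : K, r ^+ 2 = 2 -> m <> r) :
  ~ (exists P : C_point m, has_order P 2).
Proof.
case=> P /C_order2_root[x x_root].
have [a aK] : exists a : int, is_Qsqrt K a.
  by case: hK; [exists (- d%:Z) | exists d%:Z].
have [c cP] := @Qsqrt_integral_conj K a aK.
have m2x : m ^+ 2 * x = x ^+ 3 + 1.
  by apply: subr0_eq; rewrite -[RHS]oppr0 -x_root; ring.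
have x_int : in_ring_of_integers x.
  pose p := Poly [:: 1; - m ^+ 2; 0; 1].
  have pE : p = [:: 1; - m ^+ 2; 0; 1] :> seq K.
    by rewrite (@PolyK _ 1) //= oner_neq0.
  apply: (@integral_root_monic _ _ _ _ p).
  - by rewrite monicE lead_coefE pE.
  - by rewrite rootE horner_Poly /=; apply/eqP; rewrite -[RHS]x_root; ring.
  - move=> y; rewrite pE !inE => /or4P[] /eqP->.
    + exact: integral1.
    + by apply: integral_opp; apply: integral_mul.
    + exact: integral0.
    + exact: integral1.
have xV : x * (m ^+ 2 - x ^+ 2) = 1.
  by rewrite mulrBr [x * _]mulrC m2x; ring.
have xV_int : in_ring_of_integers (m ^+ 2 - x ^+ 2).
  by apply: integral_sub; apply: integral_mul.
have [t [n [et en]]] := cP x x_int.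
have [T [k [eT ek]]] := cP m m_int.
have [_ [n' [_ en']]] := cP _ xV_int.
have intrI := @rat_ext_intr_inj K.
have n2 : n = 1 \/ n = -1.
  (* [n'] is the norm of the inverse of [x]. *)
  suff nn' : n * n' = 1.
    have : (n %| n * n')%Z by rewrite dvdz_mulr.
    by rewrite nn' dvdz1; lia.
  apply: intrI; rewrite rmorphM /= -en -en'.
  by rewrite -[RHS]mulr1 -{1}xV -(rmorph1 c) -xV rmorphM; ring.
have cm2x : c m ^+ 2 * c x = c x ^+ 3 + 1.
  by rewrite -rmorphXn -rmorphM m2x rmorphD rmorphXn rmorph1.
have e1 : k ^+ 2 * n = n ^+ 3 + t ^+ 3 - 3 * n * t + 1.
  apply: intrI.
  rewrite !(rmorph_nat, rmorphXn, rmorphB, rmorphM, rmorphD, rmorph1) /=.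
  rewrite -ek -en -et.
  transitivity ((m ^+ 2 * x) * (c m ^+ 2 * c x)); first by ring.
  by rewrite m2x cm2x; ring.
have e2 : (T ^+ 2 - 2 * k) * n  = n * (t ^+ 2 - 2 * n) + t.
  apply: intrI.
  rewrite !(rmorph_nat, rmorphXn, rmorphB, rmorphM, rmorphD, rmorph1) /=.
  rewrite -ek -en -et -eT.
  (* Multiplying by the conjugate replaces the division by [x]. *)
  transitivity ((m ^+ 2 * x) * c x + (c m ^+ 2 * c x) * x); first by ring.
  by rewrite m2x cm2x; ring.
have x_quad : x ^+ 2 = t%:~R * x - n%:~R by rewrite -et -en; ring.
have x0 : x != 0.
  by apply: contra_eq_neq xV => ->; rewrite mul0r eq_sym oner_neq0.
have m2_sqrt2 : m ^+ 2 != 2 by apply/eqP => /m_neq_sqrt2.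
have m2x_neq0 : m ^+ 2 * x != 0 by rewrite mulf_neq0 ?expf_neq0 //; apply/eqP.
case: n2 => n_eq; move: x_quad; rewrite n_eq ?mulr1 ?mul1r in e1 e2 * => x_quad.
  have := @trace_of_norm1 t T k.
  case=> [||t_eq|t_eq|t_eq].
  - by rewrite e1; ring.
  - by rewrite -[T ^+ 2](subrK (2 * k)) e2; ring.
  - case/eqP: m2x_neq0; rewrite m2x.
    (* Here [x^2 - x + 1 = 0]. *)
    transitivity ((x + 1) * (x ^+ 2 - x + 1)); first by ring.
    by rewrite x_quad t_eq; ring.
  - case/eqP: m2_sqrt2.
    have x1 : x = 1.
      apply/subr0_eq/eqP; rewrite -sqrf_eq0 sqrrB1 x_quad t_eq.
      by apply/eqP; ring.
    by rewrite -[LHS]mulr1 -x1 m2x x1; ring.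
  - case/eqP: m2x_neq0; rewrite m2x.
    have x1 : x = -1.
      apply/subr0_eq/eqP; rewrite -sqrf_eq0 opprK sqrrD1 x_quad t_eq.
      by apply/eqP; ring.
    by rewrite x1; ring.
have t_eq : t = -1.
  apply: (@trace_of_normN1 t T k).
  - lia.
  - lia.
case/eqP: m2_sqrt2; apply: (mulIf x0).
rewrite m2x.
(* Here [x^2 + x - 1 = 0], so [x^3 + 1] reduces to [2 x]. *)
transitivity ((x - 1) * (x ^+ 2 + x - 1) + 2 * x); first by ring.
by rewrite x_quad t_eq; ring.
Qed.
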